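(* Let $d\ge 1$. Every unit-interval strongly-connected $d$-dimensional simplicial complex is traceable.
   Context: A labeling of a simplicial complex with $n$ vertices is a bijection of its vertex set with $\{1,\dots,n\}$. A pure $d$-dimensional simplicial complex is strongly-connected if its dual graph is connected; the dual graph has the facets as nodes, and two facets are joined by an arc iff their intersection has cardinality $d$. Strongly-connected complexes are by convention pure. A pure $d$-dimensional simplicial complex $\Delta$ with $n$ vertices is unit-interval if there is a labeling such that for every $d$-face $F=\{a_0<a_1<\dots<a_d\}$ of $\Delta$, every $(d+1)$-element subset of $\{a_0,a_0+1,\dots,a_d\}$ is a face of $\Delta$. A $d$-dimensional simplicial complex $\Delta$ with $n$ vertices is traceable if it has a labeling such that $\{i,i+1,\dots,i+d\}\in\Delta$ for all $i=1,\dots,n-d$. *)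

(* Defs.v *)
From mathcomp Require Import all_boot.

Set Implicit Arguments.
Unset Strict Implicit.
Unset Printing Implicit Defensive.

(* A finite abstract simplicial complex whose vertices are exactly the
   elements of V, so that its number n of vertices is #|V|. *)
Record complex (V : finType) := Complex {
  faces :> {set {set V}};
  face_closed : forall F G : {set V}, F \in faces -> G \subset F -> G \in faces;
  vertex_face : forall v : V, [set v] \in faces
}.

Definition facets (V : finType) (D : complex V) : {set {set V}} :=
  [set F | maxset [in faces D] F].

Definition has_dim (V : finType) (d : nat) (D : complex V) : Prop :=
  \max_(F in faces D) #|F| = d.+1.

Definition pure (V : finType) (d : nat) (D : complex V) : Prop :=
  has_dim d D /\ forall F : {set V}, F \in facets D -> #|F| = d.+1.

(* Facets are viewed inside the type of all sets of vertices; sets that are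
   not facets are isolated for this relation. *)
Definition dual_adj (V : finType) (d : nat) (D : complex V) : rel {set V} :=
  fun F G => [&& F \in facets D, G \in facets D & #|F :&: G| == d].

Definition strongly_connected (V : finType) (d : nat) (D : complex V) : Prop :=
  pure d D /\
  forall F G : {set V}, F \in facets D -> G \in facets D ->
    connect (dual_adj d D) F G.

Definition labeling (V : finType) (f : V -> nat) : Prop :=
  injective f /\ forall i : nat, 1 <= i <= #|V| <-> exists v : V, f v = i.

Definition label_interval (V : finType) (f : V -> nat) (a b : nat) : {set V} :=
  [set v | a <= f v <= b].

(* In the second condition x and y are the vertices of F with smallest and
   largest label, i.e. f x = a_0 and f y = a_d. *)
Definition unit_interval (V : finType) (d : nat) (D : complex V) : Prop :=
  pure d D /\
  exists f : V -> nat, labeling f /\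
    forall (F : {set V}) (x y : V),
      F \in faces D -> #|F| = d.+1 -> x \in F -> y \in F ->
      (forall v : V, v \in F -> f x <= f v <= f y) ->
      forall S : {set V},
        S \subset label_interval f (f x) (f y) -> #|S| = d.+1 -> S \in faces D.

Definition traceable (V : finType) (d : nat) (D : complex V) : Prop :=
  has_dim d D /\
  exists f : V -> nat, labeling f /\
    forall i : nat, 1 <= i <= #|V| - d ->
      label_interval f i (i + d) \in faces D.

(* Main.v *)
(** The labeling witnessing the unit-interval property also witnesses
    traceability.  If no facet has labels both [<= i] and [>= i + d], then the
    facets with a vertex labeled [<= i] have all labels [< i + d], whereas the
    other ones have all labels [> i]; facets of the two kinds share at most
    [d - 1] vertices, so they are never adjacent in the dual graph.  Both kinds
    occur, since [i] and [i + d] are labels of vertices. *)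
Require Import Defs.
From mathcomp Require Import all_boot.

Lemma card_label_interval_le (V : finType) (f : V -> nat) (a b : nat) :
  injective f -> #|label_interval f a b| <= b.+1 - a.
Proof.
move=> f_inj; rewrite cardE -(size_map f) -(size_iota a (b.+1 - a)).
apply: uniq_leq_size; first by rewrite map_inj_uniq ?enum_uniq.
move=> _ /mapP[v + ->]; rewrite mem_enum inE mem_iota => /andP[le_av le_vb].
by rewrite le_av subnKC ?ltnS // leqW // (leq_trans le_av).
Qed.

Lemma card_label_interval (V : finType) (f : V -> nat) (a b : nat) :
  labeling f -> 0 < a -> b <= #|V| -> #|label_interval f a b| = b.+1 - a.
Proof.
move=> [f_inj f_onto] a_gt0 b_le; apply/eqP.
rewrite eqn_leq card_label_interval_le //=.
rewrite cardE -(size_map f) -{1}(size_iota a (b.+1 - a)).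
apply: uniq_leq_size; first exact: iota_uniq.
move=> j; rewrite mem_iota => /andP[le_aj lt_j].
(* Subtraction is truncated: if [b.+1 < a], the list is empty and the bounds on [j] contradict each
   other. *)
have le_jb : j <= b.
  case: (leqP a b.+1) lt_j => [le_ab|/ltnW]; first by rewrite subnKC.
  by rewrite -subn_eq0 => /eqP->; rewrite addn0 ltnNge le_aj.
have [|v fv] := (f_onto j).1; first by rewrite (leq_trans a_gt0) //= (leq_trans le_jb).
by rewrite -fv map_f // mem_enum inE fv le_aj.
Qed.

Lemma vertex_in_facet (V : finType) (D : complex V) (v : V) :
  exists2 F, F \in facets D & v \in F.
Proof.
have [F maxF sub_vF] := @maxset_exists _ [in faces D] _ (vertex_face D v).
by exists F; rewrite ?inE // -sub1set.
Qed.

Lemma facet_face (V : finType) (D : complex V) (F : {set V}) :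
  F \in facets D -> F \in faces D.
Proof. by rewrite inE => /maxsetp. Qed.

Theorem theorem3 (V : finType) (d : nat) (D : complex V) :
  1 <= d ->
  has_dim d D ->
  unit_interval d D ->
  strongly_connected d D ->
  traceable d D.
Proof.
move=> d_gt0 dimD [[_ pureD] [f [f_lab f_unit]]] [_ connD].
split=> //; exists f; split=> // i /andP[i_gt0 i_le].
have id_le : i + d <= #|V|.
  (* An index [i >= 1] in range forces [#|V| - d] to be positive, so this subtraction is not
     truncated. *)
  have lt_dV : d < #|V| by rewrite -subn_gt0 (leq_trans i_gt0).
  by rewrite -(subnK (ltnW lt_dV)) leq_add2r.
apply: contraT => notD.
have no_span F : F \in facets D ->
    forall x y, x \in F -> y \in F -> f x <= i -> f y < i + d.
  move=> facF x y xF yF le_xi; rewrite ltnNge; apply: contra notD => le_iy.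
  (* The unit-interval condition speaks of the extreme labels of [F]. Passing from [x], [y] to the
     extremes only widens the range, which still contains the [d.+1] labels from [i] to [i + d]. *)
  case: (arg_minnP f xF) => x0 x0F x0_min.
  case: (arg_maxnP f yF) => y0 y0F y0_max.
  apply: (f_unit F x0 y0) => //; [exact: facet_face|exact: pureD| | |].
  - by move=> v vF; rewrite x0_min //=; apply: y0_max.
  - apply/subsetP => v; rewrite !inE => /andP[le_iv le_vi].
    rewrite (leq_trans (x0_min x xF)) ?(leq_trans le_xi) //=.
    by rewrite (leq_trans le_vi) // (leq_trans le_iy) //; apply: y0_max.
  - by rewrite card_label_interval // subSn ?leq_addr // addKn.
pose low (F : {set V}) := [exists x in F, f x <= i].
have low_adj F G : dual_adj d D F G -> low F -> low G.
  case/and3P=> facF facG /eqP cardFG /exists_inP[x xF le_xi].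
  apply: contraT => /exists_inPn highG.
  (* The lower bound comes from [G] not being low, the upper one from [no_span] applied to the low
     facet [F]. Only [d - 1] labels remain for [d] common vertices, which is absurd as [d > 0]. *)
  have subFG : F :&: G \subset label_interval f i.+1 (i + d).-1.
    apply/subsetP => v /setIP[vF vG]; rewrite inE ltnNge highG //=.
    by rewrite -ltnS prednK ?(no_span F facF x v) // addn_gt0 i_gt0.
  have := leq_trans (subset_leq_card subFG)
                    (card_label_interval_le _ _ _ _ f_lab.1).
  by rewrite cardFG prednK ?addn_gt0 ?i_gt0 // -addn1 subnDl
             leqNgt subn1 prednK ?leqnn.
have [|v fv] := (f_lab.2 i).1.
  by rewrite i_gt0 (leq_trans (leq_addr d i)).
have [|w fw] := (f_lab.2 (i + d)).1; first by rewrite addn_gt0 i_gt0.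
have [F facF vF] := vertex_in_facet _ D v.
have [G facG wG] := vertex_in_facet _ D w.
have lowF : low F by apply/exists_inP; exists v; rewrite ?fv.
have lowG : low G.
  (* Lowness spreads from [F] along a dual path to [G], which contains the vertex [w] labeled
     [i + d], against [no_span]. *)
  have /connectP[p pathp ->] := connD F G facF facG.
  elim: p F lowF pathp {facF vF} => //= H p IHp F lowF /andP[adjFH].
  exact: IHp (low_adj _ _ adjFH lowF).
have /exists_inP[x xG le_xi] := lowG.
by have := no_span G facG x w xG wG le_xi; rewrite fw ltnn.
Qed.
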